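(* Let $\beta\in\mathrm{Br}_n^+$ be a positive braid with Demazure product $\delta(\beta)=w_0$, and let $w=\pi(\beta)\in S_n$ be its Coxeter projection. Let $\{1,\dots,n\}=I_1\sqcup I_2$ be a decomposition such that both $I_1$ and $I_2$ are unions of $ww_0$-orbits, with $|I_1|=a$, $|I_2|=b$. Let $\beta_1\in\mathrm{Br}_a^+$, $\beta_2\in\mathrm{Br}_b^+$ be the braids obtained from $\beta$ by considering only the strands indexed by $I_1$ and $I_2$, respectively, and let $T_{I_1,I_2}=\{(t_1,\dots,t_n)\in(\mathbb{C}^\times)^n:t_i=t_j\text{ whenever } i,j\in I_1\text{ or } i,j\in I_2\}$. Then: (1) If $\delta(\beta_1)\in S_{I_1}$ and $\delta(\beta_2)\in S_{I_2}$ are the longest elements of their respective symmetric groups, then the set of elements of the braid variety $X(\beta)$ which are stabilized by $T_{I_1,I_2}$ is isomorphic to $X(\beta_1)\times X(\beta_2)$. (2) Otherwise, the set of elements of $X(\beta)$ which are stabilized by $T_{I_1,I_2}$ is empty.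
   Context: $\mathrm{Br}_n^+$ is the positive braid monoid on $n$ strands with generators $\sigma_1,\dots,\sigma_{n-1}$; $\pi(\sigma_{i_1}\cdots\sigma_{i_\ell})=s_{i_1}\cdots s_{i_\ell}\in S_n$ with $s_i=(i\ \,i+1)$ (products are compositions of functions); $w_0$ is the longest element of $S_n$. The Demazure product $\delta:\mathrm{Br}_n^+\to S_n$ is defined by $\delta(1)=1$ and $\delta(\beta\sigma_i)=\delta(\beta)s_i$ if $\ell(\delta(\beta)s_i)>\ell(\delta(\beta))$, and $\delta(\beta\sigma_i)=\delta(\beta)$ otherwise. $B_i(z)$ is the $n\times n$ identity matrix except for the block $\begin{pmatrix} z&-1\\1&0\end{pmatrix}$ in rows and columns $i,i+1$; for $\beta=\sigma_{i_1}\cdots\sigma_{i_\ell}$, $B_\beta(z)=B_{i_1}(z_1)\cdots B_{i_\ell}(z_\ell)$. The braid variety is $X(\beta)=\{(z_1,\dots,z_\ell)\in\mathbb{C}^\ell:\delta(\beta)^{-1}B_\beta(z)\text{ is upper triangular}\}$, where $\delta(\beta)$ is identified with its permutation matrix. Up to isomorphism it depends only on the braid and not on the word. Strands: draw $\beta$ from left to right on levels $1,\dots,n$, $\sigma_i$ being a crossing of the strands at levels $i$ and $i+1$; the $p$-th strand is the one at level $p$ at the left end. The torus $(\mathbb{C}^\times)^n$ acts on $X(\beta)$ by multiplying $z_k$ by $t_p/t_q$, where $p$ (resp. $q$) is the strand at level $i_k$ (resp. $i_k+1$) just before the $k$-th crossing. $\beta_j$ is obtained from the diagram of $\beta$ by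 deleting all strands not indexed by $I_j$. *)

(* Defs.v *)
From HB Require Import structures.
From mathcomp Require Export all_boot all_order all_algebra all_fingroup.
From mathcomp Require Export reals complex mpoly.

Set Implicit Arguments.
Unset Strict Implicit.
Unset Printing Implicit Defensive.

Import GRing.Theory.

(* Strands, levels and generators are numbered from 0: the letter [i : 'I_n.-1]
   is the generator crossing the levels [lower i = i] and [upper i = i + 1].
   Everything below depends on a word rather than on its class modulo the braid
   relations; positive braids are represented by arbitrary words. *)
Definition braid_word (n : nat) : Type := seq 'I_n.-1.

Lemma upper_subproof n (i : 'I_n.-1) : (i.+1 < n)%N.
Proof. by rewrite -ltn_predRL. Qed.

Lemma lower_subproof n (i : 'I_n.-1) : (i < n)%N.
Proof. exact: ltnW (upper_subproof i). Qed.

Definition lower n (i : 'I_n.-1) : 'I_n := Ordinal (lower_subproof i).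
Definition upper n (i : 'I_n.-1) : 'I_n := Ordinal (upper_subproof i).

Definition simple_refl n (i : 'I_n.-1) : 'S_n := tperm (lower i) (upper i).

(* [u o v] as functions: MathComp's product of permutations applies its left
   factor first. *)
Definition perm_comp n (u v : 'S_n) : 'S_n := (v * u)%g.

Lemma perm_compE n (u v : 'S_n) x : perm_comp u v x = u (v x).
Proof. exact: permM. Qed.

Definition coxeter_proj n (beta : braid_word n) : 'S_n :=
  foldl (fun u i => perm_comp u (simple_refl i)) 1%g beta.

Section CoxeterLength.
Variable n : nat.
Implicit Types (u v : 'S_n) (s t : braid_word n).

Lemma coxeter_proj_cat s t :
  coxeter_proj (s ++ t) = perm_comp (coxeter_proj s) (coxeter_proj t).
Proof.
elim/last_ind: t => [|t i IHt]; first by rewrite cats0 /perm_comp mul1g.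
by rewrite -rcons_cat /coxeter_proj !foldl_rcons -!/(coxeter_proj _) IHt
           /perm_comp mulgA.
Qed.

Lemma tperm_word (x y : 'I_n) : (x < y)%N ->
  exists s, coxeter_proj s = tperm x y.
Proof.
move: {2}(val y) (erefl (val y)) => k; elim: k y => [|k IHk] y /= yk xy.
  by rewrite yk in xy.
have ylt : (k < n.-1)%N by rewrite ltn_predRL -yk.
pose i := Ordinal ylt.
have yE : y = upper i by apply: val_inj.
have [xk|xk] := eqVneq (val x) k.
  exists [:: i]; rewrite /coxeter_proj /= /perm_comp mulg1 /simple_refl yE.
  by congr tperm; apply: val_inj.
have xlt : (x < lower i)%N by rewrite ltn_neqAle xk /= -ltnS -yk.
have [s sE] := IHk (lower i) erefl xlt.
exists ([:: i] ++ s ++ [:: i]); rewrite !coxeter_proj_cat sE.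
rewrite /coxeter_proj /= /perm_comp !mulg1.
rewrite yE; have <- : (tperm x (lower i) ^ simple_refl i)%g = tperm x (upper i).
  rewrite tpermJ /simple_refl tpermL tpermD // -val_eqE /= gtn_eqF //.
  by rewrite ltnS ltnW.
by rewrite /conjg /simple_refl tpermV mulgA.
Qed.

Lemma coxeter_proj_surj u : exists s, coxeter_proj s = u.
Proof.
have [ts -> _] := prod_tpermP u.
elim: ts => [|[x y] ts [s IHs]]; first by exists [::]; rewrite big_nil.
have [t tE] : exists t, coxeter_proj t = tperm x y.
  case: (ltngtP x y) => [xy|yx|/val_inj->]; first exact: tperm_word.
    by rewrite tpermC; apply: tperm_word.
  by exists [::]; rewrite tperm1.
by exists (s ++ t); rewrite big_cons coxeter_proj_cat IHs tE.
Qed.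

Lemma coxeter_length_subproof u :
  exists k, [exists t : k.-tuple 'I_n.-1, coxeter_proj t == u].
Proof.
have [s <-] := coxeter_proj_surj u.
by exists (size s); apply/existsP; exists (in_tuple s).
Qed.

Definition coxeter_length u : nat := ex_minn (coxeter_length_subproof u).

End CoxeterLength.

Definition longest_perm (n : nat) : 'S_n :=
  [arg max_(u > 1%g) coxeter_length u].

Definition demazure n (beta : braid_word n) : 'S_n :=
  foldl (fun u i =>
           if (coxeter_length u < coxeter_length (perm_comp u (simple_refl i)))%N
           then perm_comp u (simple_refl i) else u) 1%g beta.

(* [strand_at beta l] is the strand found at level [l] at the right end of the
   diagram of [beta], strands being named by their level at the left end. *)
Definition strand_at n (beta : braid_word n) : 'I_n -> 'I_n :=
  foldl (fun f i => f \o simple_refl i) id beta.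

(* Strands of [I] are renumbered increasingly from [0] to [#|I| - 1].  A crossing
   of two of them survives, at the level given by the number of strands of [I]
   lying strictly below it; [strands_below_lt] shows that [insub] never fails
   there. *)
Definition strands_below n (I : {set 'I_n}) (f : 'I_n -> 'I_n) (l : 'I_n) : nat :=
  #|[set m : 'I_n | (m < l)%N && (f m \in I)]|.

Definition sub_letter n (I : {set 'I_n}) (beta : braid_word n) (i : 'I_n.-1) :
    option 'I_#|I|.-1 :=
  let f := strand_at beta in
  if (f (lower i) \in I) && (f (upper i) \in I)
  then insub (strands_below I f (lower i)) else None.

Definition sub_braid n (I : {set 'I_n}) (beta : braid_word n) :
    braid_word #|I| :=
  pmap (fun k : 'I_(size beta) =>
          sub_letter I (take k beta) (tnth (in_tuple beta) k))
       (enum 'I_(size beta)).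

Lemma strand_at_inj n (beta : braid_word n) : injective (strand_at beta).
Proof.
elim/last_ind: beta => [|beta i IH]; first exact: inj_id.
by rewrite /strand_at foldl_rcons; apply: inj_comp => //; apply: perm_inj.
Qed.

Lemma strands_below_lt n (I : {set 'I_n}) (beta : braid_word n) (i : 'I_n.-1) :
  strand_at beta (lower i) \in I -> strand_at beta (upper i) \in I ->
  (strands_below I (strand_at beta) (lower i) < #|I|.-1)%N.
Proof.
set f := strand_at beta => lI uI.
rewrite ltn_predRL /strands_below; set A := [set m | _].
have lA : lower i \notin A by rewrite inE ltnn.
have uA : upper i \notin lower i |: A.
  by rewrite !inE -val_eqE /= gtn_eqF //= ltnNge leqnSn.
have <- : #|upper i |: (lower i |: A)| = #|A|.+2 by rewrite !cardsU1 lA uA.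
rewrite -(card_imset _ (@strand_at_inj n beta)); apply/subset_leq_card/subsetP.
by move=> _ /imsetP[m + ->]; rewrite !inE => /or3P[/eqP->|/eqP->|/andP[]].
Qed.

Local Open Scope ring_scope.

Section BraidVariety.
Variables (K : fieldType) (n : nat).
Implicit Types (beta : braid_word n) (I : {set 'I_n}).

Definition braid_gen_mx (i : 'I_n.-1) (z : K) : 'M[K]_n :=
  \matrix_(r, c)
    if (r == lower i) && (c == lower i) then z
    else if (r == lower i) && (c == upper i) then -1
    else if (r == upper i) && (c == lower i) then 1
    else if (r == upper i) && (c == upper i) then 0
    else (r == c)%:R.

Definition braid_mx beta (z : 'rV[K]_(size beta)) : 'M[K]_n :=
  \big[mulmx/1%:M]_(k < size beta)
     braid_gen_mx (tnth (in_tuple beta) k) (z ord0 k).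

(* The matrix sending the basis column [e_j] to [e_(u j)].  It is the transpose
   of MathComp's [perm_mx u], and multiplicative for composition. *)
Definition permutation_mx (u : 'S_n) : 'M[K]_n :=
  \matrix_(r, c) (r == u c)%:R.

Definition upper_triangular (A : 'M[K]_n) : Prop :=
  forall r c : 'I_n, (c < r)%N -> A r c = 0.

Definition braid_variety beta (z : 'rV[K]_(size beta)) : Prop :=
  upper_triangular (invmx (permutation_mx (demazure beta)) *m braid_mx z).

Definition in_torus (t : 'rV[K]_n) : Prop := forall p, t ord0 p != 0.

Definition torus_act beta (t : 'rV[K]_n) (z : 'rV[K]_(size beta)) :
    'rV[K]_(size beta) :=
  \row_k
    let i := tnth (in_tuple beta) k in
    let f := strand_at (take k beta) in
    t ord0 (f (lower i)) / t ord0 (f (upper i)) * z ord0 k.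

Definition in_subtorus (I1 I2 : {set 'I_n}) (t : 'rV[K]_n) : Prop :=
  in_torus t /\
  forall p q, (p \in I1) && (q \in I1) || (p \in I2) && (q \in I2) ->
    t ord0 p = t ord0 q.

Definition stabilized_points beta I1 I2 (z : 'rV[K]_(size beta)) : Prop :=
  braid_variety z /\ forall t, in_subtorus I1 I2 t -> torus_act t z = z.

End BraidVariety.

Definition union_of_orbits n (u : 'S_n) (I : {set 'I_n}) : Prop :=
  exists2 P : {set {set 'I_n}}, P \subset porbits u & I = cover P.

(* Affine varieties over [K] are given as closed subsets of affine spaces [K^l]:
   regular maps between them are the restrictions of polynomial maps. *)
Section AffineSets.
Variable K : fieldType.

Definition poly_map l m (F : 'I_m -> {mpoly K[l]}) (z : 'rV[K]_l) : 'rV[K]_m :=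
  \row_j (F j).@[z ord0].

Definition product_set l m (X : 'rV[K]_l -> Prop) (Y : 'rV[K]_m -> Prop)
    (z : 'rV[K]_(l + m)) : Prop :=
  X (lsubmx z) /\ Y (rsubmx z).

Definition isomorphic_sets l m (X : 'rV[K]_l -> Prop) (Y : 'rV[K]_m -> Prop) :
    Prop :=
  exists (F : 'I_m -> {mpoly K[l]}) (G : 'I_l -> {mpoly K[m]}),
    (forall z, X z -> Y (poly_map F z) /\ poly_map G (poly_map F z) = z) /\
    (forall z, Y z -> X (poly_map G z) /\ poly_map F (poly_map G z) = z).

End AffineSets.

Arguments braid_variety K {n} beta z.
Arguments stabilized_points K {n} beta I1 I2 z.

(* Main.v *)
From HB Require Import structures.
Require Import Defs.
From mathcomp Require Import zify ring.

Set Implicit Arguments.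
Unset Strict Implicit.
Unset Printing Implicit Defensive.

Import GRing.Theory.

(* A point is fixed by the subtorus iff its coordinates at the crossings of a
   strand of I1 with a strand of I2 vanish.  At such a crossing the braid matrix is
   a signed permutation matrix, so the matrix of beta splits along the strands of
   I1 and I2 into two blocks, which are the matrices of beta1 and beta2 up to signs
   of the coordinates and of the columns.  Since I1 and I2 are unions of orbits of
   w w0, the antidiagonal of the whole matrix splits into the antidiagonals of the
   blocks, so that the equations of X(beta) become those of X(beta1) x X(beta2)
   whenever both Demazure products are longest elements.  They are so as soon as
   there is a fixed point: the lower-left corner ranks of a braid matrix are at
   most those of the permutation matrix of its Demazure product, and a braid matrix
   vanishing above its antidiagonal has the corner ranks of w0. *)

(** * Inversions, Coxeter length and the longest permutation *)

Section Inversions.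
Variable n : nat.
Implicit Types (u v : 'S_n) (i : 'I_n.-1) (x y : 'I_n).

(** Reindexing by [u] shows that the values [u x] have the same sum as the [x], so every inequality
    is an equality. *)
Lemma perm_ge_id u : (forall x, x <= u x) -> u = 1%g.
Proof.
move=> ux; apply/permP => x; rewrite perm1; apply/val_inj/esym/eqP.
have [_ /esym] := @leqif_sum _ xpredT _ _ _ (fun x _ => leqif_eq (ux x)).
by rewrite [X in X == _](reindex_inj (@perm_inj _ u)) eqxx => /forallP/(_ x).
Qed.

Lemma perm_increasing_id u : (forall x y, x < y -> u x < u y) -> u = 1%g.
Proof.
move=> uP; apply: perm_ge_id => x.
case: x => k kn; elim: k kn => [//|k IH] kn.
by apply: leq_ltn_trans (IH (ltnW kn)) (uP _ _ _) => /=.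
Qed.

Lemma simple_refl_ltn i x y : (x, y) != (lower i, upper i) ->
  (x, y) != (upper i, lower i) -> (simple_refl i x < simple_refl i y) = (x < y).
Proof.
rewrite !xpair_eqE /simple_refl.
by case: tpermP => [->|->|/eqP xl /eqP xu]; case: tpermP => [->|->|/eqP yl /eqP yu];
  rewrite ?eqxx //; try move: xl xu; try move: yl yu; rewrite -?val_eqE /=; lia.
Qed.

Lemma simple_reflK i : involutive (simple_refl i).
Proof. exact: tpermK. Qed.

Definition inversions u : {set 'I_n * 'I_n} :=
  [set p : 'I_n * 'I_n | (p.1 < p.2) && (u p.2 < u p.1)].

(** Applying [simple_refl i] to both coordinates keeps the order of every pair except that of the
    two exchanged levels, which is the one new inversion. *)
Lemma card_inversions_simple_refl u i : u (lower i) < u (upper i) ->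
  #|inversions (perm_comp u (simple_refl i))| = #|inversions u|.+1.
Proof.
move=> ui; pose s (p : 'I_n * 'I_n) := (simple_refl i p.1, simple_refl i p.2).
have sK : involutive s by case=> x y; rewrite /s /= !simple_reflK.
rewrite -(card_imset _ (inv_inj sK)).
have -> : [set s p | p in inversions (perm_comp u (simple_refl i))] =
          (upper i, lower i) |: inversions u.
  apply/setP => p; rewrite -{1}(sK p) (mem_imset _ _ (inv_inj sK)) !inE.
  case: p => x y /=; rewrite !perm_compE !simple_reflK.
  have [[-> ->]|nul] := eqVneq (x, y) (upper i, lower i).
    by rewrite /simple_refl tpermL tpermR /= leqnn ui.
  have [[-> ->]|nlu] := eqVneq (x, y) (lower i, upper i).
    by rewrite /simple_refl tpermL tpermR /=; lia.
  by rewrite simple_refl_ltn.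
by rewrite cardsU1 inE /= ltnNge leqnSn.
Qed.

Lemma perm_comp_simple_reflK u i :
  perm_comp (perm_comp u (simple_refl i)) (simple_refl i) = u.
Proof. by apply/permP => x; rewrite !perm_compE simple_reflK. Qed.

Lemma card_inversions_simple_refl_desc u i : u (upper i) < u (lower i) ->
  #|inversions u| = #|inversions (perm_comp u (simple_refl i))|.+1.
Proof.
move=> ui; rewrite -(@card_inversions_simple_refl _ i) ?perm_comp_simple_reflK //.
by rewrite !perm_compE /simple_refl tpermL tpermR.
Qed.

Lemma simple_refl_ascent_dec u i :
  (u (lower i) < u (upper i)) || (u (upper i) < u (lower i)).
Proof.
by rewrite -neq_ltn val_eqE (inj_eq perm_inj) -val_eqE /= ltn_eqF.
Qed.

Lemma coxeter_proj_rcons (beta : braid_word n) i :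
  coxeter_proj (rcons beta i) = perm_comp (coxeter_proj beta) (simple_refl i).
Proof. by rewrite /coxeter_proj foldl_rcons. Qed.

Lemma card_inversions_le_size (beta : braid_word n) :
  #|inversions (coxeter_proj beta)| <= size beta.
Proof.
elim/last_ind: beta => [|beta i IH].
  rewrite leqn0 cards_eq0; apply/eqP/setP => -[x y].
  by rewrite !inE /coxeter_proj /= !perm1; lia.
rewrite coxeter_proj_rcons size_rcons.
have /orP[ui|ui] := simple_refl_ascent_dec (coxeter_proj beta) i.
  by rewrite card_inversions_simple_refl.
by move: IH; rewrite (card_inversions_simple_refl_desc ui); lia.
Qed.

Lemma increasing_no_descent u :
  (forall i, u (lower i) < u (upper i)) -> forall x y, x < y -> u x < u y.
Proof.
move=> ui x y xy.
case: y xy => k kn; elim: k kn => [//|k IH] kn xy.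
have kn' : k < n.-1 by rewrite ltn_predRL.
have -> : Ordinal kn = upper (Ordinal kn') by apply: val_inj.
have := ui (Ordinal kn').
have [xk|xk] := eqVneq (val x) k.
  by have -> : lower (Ordinal kn') = x by apply: val_inj.
apply: leq_trans; have -> : lower (Ordinal kn') = Ordinal (ltnW kn) by apply: val_inj.
by apply: leqW; apply: IH; move: xk xy => /=; lia.
Qed.

(** Descents are removed one by one, each costing one inversion; a permutation without descents is
    increasing, hence trivial. *)
Lemma reduced_word u : exists2 beta : braid_word n,
  coxeter_proj beta = u & size beta = #|inversions u|.
Proof.
have [k uk] := ubnP #|inversions u|; elim: k u uk => // k IH u uk.
have [/existsP[i ui]|/existsPn H] := boolP [exists i, u (upper i) < u (lower i)].
  have E := card_inversions_simple_refl_desc ui.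
  have [|beta bE bs] := IH (perm_comp u (simple_refl i)).
    by rewrite E in uk.
  exists (rcons beta i); first by rewrite coxeter_proj_rcons bE perm_comp_simple_reflK.
  by rewrite size_rcons bs E.
have u1 : u = 1%g.
  apply/perm_increasing_id/increasing_no_descent => i.
  by have := simple_refl_ascent_dec u i; rewrite (negPf (H i)) orbF.
exists [::]; first by rewrite u1.
apply/esym/eqP; rewrite -leqn0.
by have := @card_inversions_le_size [::]; rewrite u1.
Qed.

Lemma coxeter_lengthE u : coxeter_length u = #|inversions u|.
Proof.
rewrite /coxeter_length; case: ex_minnP => m /existsP[t /eqP tE] min_m.
apply/eqP; rewrite eqn_leq; apply/andP; split.
  have [beta bE bs] := reduced_word u.
  by rewrite -bs; apply: min_m; apply/existsP; exists (in_tuple beta); rewrite bE.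
by rewrite -tE -[X in _ <= X](size_tuple t) card_inversions_le_size.
Qed.

Lemma coxeter_length_ascent u i :
  (coxeter_length u < coxeter_length (perm_comp u (simple_refl i))) =
  (u (lower i) < u (upper i)).
Proof.
rewrite !coxeter_lengthE.
have /orP[ui|ui] := simple_refl_ascent_dec u i.
  by rewrite card_inversions_simple_refl // ui ltnS leqnn.
by rewrite (card_inversions_simple_refl_desc ui); lia.
Qed.

Definition rev_perm : 'S_n := perm (@rev_ord_inj n).

Lemma perm_ge_rev u : (forall x, rev_ord x <= u x) -> u = rev_perm.
Proof.
move=> H; have -> : u = (rev_perm * (rev_perm * u))%g.
  by apply/permP => x; rewrite !permM !permE rev_ordK.
suff -> : (rev_perm * u)%g = 1%g by rewrite mulg1.
apply: perm_ge_id => x; rewrite permM permE.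
by apply: leq_trans (H _); rewrite rev_ordK.
Qed.

(** Every increasing pair is an inversion of [rev_perm], so a permutation of maximal length inverts
    all of them too; composed with the reversal it is increasing. *)
Lemma longest_permE : longest_perm n = rev_perm.
Proof.
rewrite /longest_perm; case: arg_maxnP => // u _ /(_ rev_perm isT).
rewrite /= !coxeter_lengthE /geq /= => Hu.
have revT : inversions rev_perm = [set p : 'I_n * 'I_n | p.1 < p.2].
  apply/setP => -[x y]; rewrite !inE /= !permE /=.
  have := ltn_ord x; have := ltn_ord y; lia.
have uT : inversions u = inversions rev_perm.
  apply/eqP; rewrite eqEcard Hu andbT revT.
  by apply/subsetP => p; rewrite !inE => /andP[].
have K1 : (rev_perm * u)%g = 1%g.
  apply: perm_increasing_id => x y xy; rewrite !permM !permE.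
  have: (rev_ord y, rev_ord x) \in inversions u.
    rewrite uT revT inE /=; have := ltn_ord x; have := ltn_ord y; lia.
  by rewrite inE => /andP[].
have: (rev_perm * (rev_perm * u))%g = rev_perm by rewrite K1 mulg1.
move=> <-; apply/permP => x.
by rewrite !permM !permE rev_ordK.
Qed.

End Inversions.

Local Open Scope ring_scope.

(** * Braid matrices, corner ranks and the Demazure product *)

Section BraidMatrices.
Variables (K : fieldType) (n : nat).
Implicit Types (beta : braid_word n) (i : 'I_n.-1) (M : 'M[K]_n) (u : 'S_n).

Lemma upper_neq_lower i : (upper i == lower i) = false.
Proof. by rewrite -val_eqE /= gtn_eqF. Qed.

Lemma mulmx_braid_gen m (M : 'M[K]_(m, n)) i z r c :
  (M *m braid_gen_mx i z) r c =
    if c == lower i then z * M r (lower i) + M r (upper i)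
    else if c == upper i then - M r (lower i) else M r c.
Proof.
have lu : (lower i == upper i) = false by rewrite eq_sym upper_neq_lower.
rewrite mxE (bigD1 (lower i)) //= (bigD1 (upper i)) ?upper_neq_lower //=.
rewrite !mxE !eqxx !upper_neq_lower /=.
have [->|cl] := eqVneq c (lower i).
  rewrite mulrC mulr1 addrA big1 ?addr0 // => k /andP[/negPf kl /negPf ku].
  by rewrite !mxE kl ku /= mulr0.
have [->|cu] := eqVneq c (upper i).
  rewrite /= mulr0 add0r mulrN1 big1 ?addr0 // => k /andP[/negPf kl /negPf ku].
  by rewrite !mxE kl ku /= mulr0.
rewrite lu /= !mulr0 !add0r (bigD1 c) ?cl ?cu //=.
rewrite !mxE (negPf cl) (negPf cu) /= eqxx mulr1 big1 ?addr0 // => k.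
by move=> /andP[/andP[/negPf kl /negPf ku] /negPf kc]; rewrite !mxE kl ku kc /= mulr0.
Qed.

Lemma braid_gen_unitmx i (z : K) : braid_gen_mx i z \in unitmx.
Proof.
rewrite -row_free_unit -kermx_eq0; apply/eqP/row_matrixP => r; rewrite row0.
have : row r (kermx (braid_gen_mx i z)) *m braid_gen_mx i z = 0.
  by apply/sub_kermxP/row_sub.
move: (row r _) => v /matrixP v0; apply/rowP => c.
(* Column [upper i] kills the entry of [v] at [lower i]; column [lower i] then kills the one at
   [upper i]. *)
have /eqP vl := v0 ord0 (upper i); have /eqP vu := v0 ord0 (lower i).
rewrite mulmx_braid_gen upper_neq_lower eqxx mxE oppr_eq0 in vl.
rewrite mulmx_braid_gen eqxx (eqP vl) mulr0 add0r mxE in vu.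
have := v0 ord0 c; rewrite mulmx_braid_gen mxE.
have [->|_] := eqVneq c (lower i); first by rewrite (eqP vl).
by have [->|_] := eqVneq c (upper i); first by rewrite (eqP vu).
Qed.

HB.instance Definition _ :=
  Monoid.isLaw.Build 'M[K]_n 1%:M mulmx (@mulmxA _ _ _ _ _) (@mul1mx _ _ _) (@mulmx1 _ _ _).

(* The coordinates are taken from a sequence [y : nat -> K] so that [braid_mx]
   can be handled by induction on the word without casts between row vectors. *)
Definition word_mx beta (y : nat -> K) : 'M[K]_n :=
  braid_mx (\row_(k < size beta) y k).

Lemma word_mx_nil y : word_mx [::] y = 1%:M.
Proof. by rewrite /word_mx /braid_mx big_ord0. Qed.

Lemma word_mx_rcons beta i y :
  word_mx (rcons beta i) y = word_mx beta y *m braid_gen_mx i (y (size beta)).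
Proof.
have E b : word_mx b y =
    \big[mulmx/1%:M]_(k < size b) braid_gen_mx (nth i b k) (y k).
  by apply: eq_bigr => k _; rewrite mxE (tnth_nth i).
rewrite !E size_rcons. rewrite big_ord_recr /= nth_rcons ltnn eqxx.
congr (_ *m _); apply: eq_bigr => k _.
by rewrite nth_rcons ltn_ord.
Qed.

Lemma word_mx_unit beta y : word_mx beta y \in unitmx.
Proof.
elim/last_ind: beta => [|beta i IH]; first by rewrite word_mx_nil unitmx1.
by rewrite word_mx_rcons unitmx_mul IH braid_gen_unitmx.
Qed.

(** The block of rows from [a] on and columns before [c], padded with zeros so that all corners live
    in one matrix type. *)
Definition corner_rank M a c : nat := \rank (copid_mx a *m M *m pid_mx c : 'M_n).

(** The rank of that corner for [permutation_mx u]: the number of ones lying in it. *)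
Definition corner_count u a c : nat := #|[set j : 'I_n | (j < c)%N && (a <= u j)%N]|.

Lemma corner_rankS M a c : (corner_rank M a c.+1 <= (corner_rank M a c).+1)%N.
Proof.
have [cn|nc] := ltnP c n; last first.
  rewrite /corner_rank; suff -> : pid_mx c.+1 = pid_mx c :> 'M[K]_n by [].
  by rewrite -pid_mx_minv -[RHS]pid_mx_minv; congr pid_mx; lia.
have E : pid_mx c.+1 = pid_mx c + delta_mx (Ordinal cn) (Ordinal cn) :> 'M[K]_n.
  apply/matrixP => r s; rewrite !mxE -!val_eqE /= ltnS leq_eqVlt.
  have [<-|rs] := eqVneq (r : nat) s; last first.
    by have [<-|] := eqVneq (r : nat) c; rewrite ?addr0 // eq_sym (negPf rs) addr0.
  by case: (ltngtP r c); rewrite /= ?addr0 ?add0r.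
rewrite /corner_rank E mulmxDr -addn1; apply: leq_trans (mxrank_add _ _) _.
rewrite leq_add2l; apply: leq_trans (mxrankM_maxr _ _) _.
by rewrite mxrank_delta.
Qed.

Lemma pid_mulmxE m (A : 'M[K]_(n, m)) c r s :
  (pid_mx c *m A : 'M_(n, m)) r s = (r < c)%N%:R * A r s.
Proof.
rewrite mxE (bigD1 r) //= mxE eqxx /= big1 ?addr0 // => k kr.
by rewrite mxE eq_sym; rewrite -val_eqE /= in kr; rewrite (negPf kr) mul0r.
Qed.

Lemma mulmx_pidE m (A : 'M[K]_(m, n)) c r s :
  (A *m pid_mx c : 'M_(m, n)) r s = A r s * (s < c)%N%:R.
Proof.
rewrite mxE (bigD1 s) //= mxE eqxx /= big1 ?addr0 // => k ks.
by rewrite mxE; rewrite -val_eqE /= in ks; rewrite (negPf ks) mulr0.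
Qed.

(** The first [c] columns of the product are combinations of the first [c'] columns of [M]. Only for
    [c = i + 1] does column [upper i] enter from outside, whence the second condition. *)
Lemma corner_rank_braid_gen M i z a c c' :
  (c <= c')%N -> (c == i.+1 -> c < c')%N ->
  (corner_rank (M *m braid_gen_mx i z) a c <= corner_rank M a c')%N.
Proof.
move=> cc' ic.
have E : braid_gen_mx i z *m pid_mx c =
         pid_mx c' *m (braid_gen_mx i z *m pid_mx c) :> 'M_n.
  apply/matrixP => r s; rewrite pid_mulmxE mulmx_pidE.
  have [sc|] := ltnP s c; last by rewrite !mulr0.
  have [rc|rc] := ltnP r c'; first by rewrite mul1r.
  rewrite mul0r mulr1 mxE -!val_eqE /=.
  by do ![case: eqP => //= ?]; lia.
rewrite /corner_rank -!mulmxA E !mulmxA -[_ *m _ *m pid_mx c]mulmxA; exact: mxrankM_maxl.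
Qed.

Lemma corner_countS u a (j : 'I_n) :
  corner_count u a j.+1 = (corner_count u a j + (a <= u j))%N.
Proof.
rewrite /corner_count.
have [au|/negPf ua] := boolP (a <= u j)%N; last first.
  rewrite addn0; apply: eq_card => k; rewrite !inE ltnS leq_eqVlt.
  by have [/val_inj->|] := eqVneq (k : nat) j; rewrite // ua !andbF.
have -> : [set k : 'I_n | (k < j.+1)%N && (a <= u k)%N] =
    j |: [set k : 'I_n | (k < j)%N && (a <= u k)%N].
  apply/setP => k; rewrite !inE ltnS leq_eqVlt -val_eqE /=.
  by have [/val_inj->|] := eqVneq (k : nat) j; rewrite ?au.
by rewrite cardsU1 inE ltnn addnC.
Qed.

Lemma corner_count_le u a c : (c <= n)%N -> (corner_count u a c <= c)%N.
Proof.
elim: c => [|c IH] cn; first by rewrite leqn0 cards_eq0; apply/eqP/setP => k; rewrite !inE.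
rewrite (corner_countS u a (Ordinal cn)) /=.
by case: (a <= _)%N; rewrite ?addn1 ?addn0 ?ltnS ?leqW ?IH // ltnW.
Qed.

(** Unless it separates the levels [i] and [i + 1], the initial segment of length [c] is stable
    under [simple_refl i]. *)
Lemma corner_count_simple_refl u i a c : c != i.+1 ->
  corner_count (perm_comp u (simple_refl i)) a c = corner_count u a c.
Proof.
move=> ci; rewrite /corner_count -(card_imset _ (@perm_inj _ (simple_refl i))).
apply: eq_card => k; rewrite -{1}(simple_reflK i k) mem_imset ?inE; last exact: perm_inj.
rewrite perm_compE simple_reflK; congr (_ && _).
by rewrite /simple_refl; case: tpermP => [->|->|//] /=; lia.
Qed.

Lemma demazure_rcons beta i :
  demazure (rcons beta i) =
    if (demazure beta (lower i) < demazure beta (upper i))%N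
    then perm_comp (demazure beta) (simple_refl i) else demazure beta.
Proof. by rewrite /demazure foldl_rcons -/(demazure _) coxeter_length_ascent. Qed.

(* The lower-left corner ranks of a matrix of the Bruhat cell of [u] are given by
   [corner_count u]: this says that [word_mx beta y] lies in the closure of the
   cell of [demazure beta]. *)
Lemma corner_rank_word_mx beta y a c :
  (corner_rank (word_mx beta y) a c <= corner_count (demazure beta) a c)%N.
Proof.
elim/last_ind: beta c => [|beta i IH] c.
  rewrite word_mx_nil /corner_rank mulmx1.
  rewrite /corner_count.
  set S := [set j : 'I_n | _].
  (* For the empty word the corner is a sum of diagonal units, one for each element of [S], each of
     rank one. *)
  have -> : copid_mx a *m pid_mx c = \sum_(j in S) delta_mx j j :> 'M[K]_n.
    apply/matrixP => r s; rewrite mulmx_pidE !mxE summxE.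
    under eq_bigr do rewrite mxE.
    have [<-|rs] := eqVneq r s; last first.
      rewrite big1 => [|j _]; last by case: eqP => [<-|//]; rewrite eq_sym (negPf rs).
      by move: rs; rewrite -val_eqE /= => /negPf->; rewrite subr0 mul0r.
    rewrite eqxx /=; under eq_bigr do rewrite andbb.
    have [rS|rS] := boolP (r \in S).
      rewrite (bigD1 r) //= eqxx big1 => [|j]; last first. by case/andP=> _ /negPf jr; rewrite eq_sym jr.
      move: rS; rewrite inE perm1 => /andP[rc ar]; rewrite rc.
      by rewrite ltnNge ar subr0 mulr1 addr0.
    rewrite big1 => [|j jS]; last by case: eqP => // rj; rewrite -rj (negPf rS) in jS.
    move: rS; rewrite inE perm1 negb_and => /orP[/negPf->|]; first by rewrite mulr0.
    by rewrite -ltnNge => ->; rewrite subrr mul0r.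
  rewrite -sum1_card; elim/big_rec2: _ => [|j m A _ IH]; first by rewrite mxrank0.
  by apply: leq_trans (mxrank_add _ _) _; rewrite mxrank_delta leq_add2l.
rewrite word_mx_rcons demazure_rcons; set u := demazure beta in IH *.
set M := word_mx beta y in IH *.
have [->|ci] := eqVneq c i.+1; last first.
  have H : (corner_rank (M *m braid_gen_mx i (y (size beta))) a c
             <= corner_count u a c)%N.
    by apply: leq_trans (IH c); apply: corner_rank_braid_gen => //; rewrite (negPf ci).
  by case: ifP => // _; rewrite corner_count_simple_refl.
(* At [c = i + 1], [H1] adds one column to the first [i], and [H2] passes to the first [i + 2]
   columns of [M]. In both cases of [demazure_rcons] the value at [lower i] becomes the larger of
   [u (lower i)] and [u (upper i)]: if it is at least [a], [H1] suffices; otherwise neither value is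
   counted and [H2] suffices. *)
have H1 : (corner_rank (M *m braid_gen_mx i (y (size beta))) a i.+1
           <= (corner_count u a i).+1)%N.
  apply: leq_trans (corner_rankS _ _ _) _; rewrite ltnS; apply: leq_trans (IH i).
  by apply: corner_rank_braid_gen => //; lia.
have H2 : (corner_rank (M *m braid_gen_mx i (y (size beta))) a i.+1
           <= corner_count u a i.+2)%N.
  by apply: leq_trans (IH _); apply: corner_rank_braid_gen => //.
have L v : corner_count v a i.+1 = (corner_count v a i + (a <= v (lower i)))%N.
  exact: (corner_countS v a (lower i)).
have U := corner_countS u a (upper i); rewrite /= L in U.
case: ifP => ui; rewrite L.
  rewrite corner_count_simple_refl ?perm_compE; last by lia.
  rewrite /simple_refl tpermL; case: (leqP a (u (upper i))) U => au U.
    by rewrite addn1.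
  by apply: leq_trans H2 _; rewrite U addn0 leq_add2l [(a <= _)%N]leqNgt (ltn_trans ui au).
move/negbT: ui; rewrite -leqNgt => ui.
case: (leqP a (u (lower i))) U => au U; first by rewrite addn1.
by apply: leq_trans H2 _; rewrite U addn0 [(a <= u _)%N]leqNgt (leq_ltn_trans ui au) addn0.
Qed.

Definition antitriangular (A : 'M[K]_n) : Prop :=
  forall r c : 'I_n, (r + c < n.-1)%N -> A r c = 0.

(** The first [j + 1] columns are independent and supported in the rows from [rev_ord j] on, so this
    corner has full rank [j + 1]. The rank bound then forces column [j] to be counted:
    [rev_ord j <= demazure beta j]. *)
Lemma antitriangular_demazure beta y :
  antitriangular (word_mx beta y) -> demazure beta = rev_perm n.
Proof.
move=> anti; apply: perm_ge_rev => j.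
have := corner_rank_word_mx beta y (rev_ord j) j.+1.
have -> : corner_rank (word_mx beta y) (rev_ord j) j.+1 = j.+1.
  rewrite /corner_rank -mulmxA.
  have -> : copid_mx (rev_ord j) *m (word_mx beta y *m pid_mx j.+1) =
      word_mx beta y *m pid_mx j.+1 :> 'M_n.
    rewrite mulmxBl mul1mx; apply/matrixP => r c; rewrite [LHS]mxE [X in _ + X]mxE.
    rewrite pid_mulmxE mulmx_pidE; have [cj|] := ltnP c j.+1; last by rewrite !mulr0 subr0.
    have [rj|] := ltnP r (rev_ord j); last by rewrite mul0r subr0.
    by rewrite anti ?mul0r ?mulr0 ?subr0 //=; move: rj cj => /=; lia.
  rewrite eqmxMfull ?rank_pid_mx // row_full_unit; exact: word_mx_unit.
rewrite corner_countS => H.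
have := corner_count_le (demazure beta) (rev_ord j) (ltnW (ltn_ord j)).
by case: leqP H => //; lia.
Qed.

(** The permutation matrix of w0 is its own inverse and reverses the rows, exchanging diagonal and
    antidiagonal. *)
Lemma braid_variety_rev beta (y : nat -> K) : demazure beta = rev_perm n ->
  braid_variety K beta (\row_(k < size beta) y k) <-> antitriangular (word_mx beta y).
Proof.
move=> D; rewrite /braid_variety D.
have P1 (A : 'M[K]_n) r c : (permutation_mx K (rev_perm n) *m A) r c = A (rev_ord r) c.
  rewrite mxE (bigD1 (rev_ord r)) //= mxE permE rev_ordK eqxx mul1r big1 ?addr0 // => k kr.
  by rewrite mxE permE -(inj_eq rev_ord_inj) rev_ordK eq_sym (negPf kr) mul0r.
have PP : permutation_mx K (rev_perm n) *m permutation_mx K (rev_perm n) = 1%:M.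
  by apply/matrixP => r c; rewrite P1 !mxE permE (inj_eq rev_ord_inj).
have -> : invmx (permutation_mx K (rev_perm n)) = permutation_mx K (rev_perm n).
  have [Pu _] := mulmx1_unit PP.
  by rewrite -[RHS]mul1mx -(mulVmx Pu) -mulmxA PP mulmx1.
rewrite -/(word_mx beta y); split=> H r c rc.
  rewrite -(rev_ordK r) -P1 H //=; have := ltn_ord r; lia.
by rewrite P1 H //=; have := ltn_ord r; lia.
Qed.

End BraidMatrices.

(** * Levels and crossings of the sub-braids *)

Section SubBraids.
Variables (n : nat) (I : {set 'I_n}).
Implicit Types (beta : braid_word n) (i : 'I_n.-1) (f : 'I_n -> 'I_n) (l m : 'I_n).

Lemma strands_below_ltn f l m : f l \in I -> (l < m)%N ->
  (strands_below I f l < strands_below I f m)%N.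
Proof.
move=> lI lm; apply/proper_card/properP; split.
  by apply/subsetP => k; rewrite !inE => /andP[kl ->]; rewrite (ltn_trans kl lm).
by exists l; rewrite !inE ?lm ?lI // ltnn.
Qed.

Lemma strands_below_leq f l m : (l <= m)%N ->
  (strands_below I f l <= strands_below I f m)%N.
Proof.
move=> lm; apply/subset_leq_card/subsetP => k.
by rewrite !inE => /andP[kl ->]; rewrite (leq_trans kl lm).
Qed.

Lemma strands_below_inj f l m : f l \in I -> f m \in I ->
  (strands_below I f l == strands_below I f m) = (l == m).
Proof.
move=> lI mI; rewrite -val_eqE /=; apply/eqP/eqP => [|/val_inj->] //.
by case: (ltngtP l m) => // [/(strands_below_ltn lI)|/(strands_below_ltn mI)]; lia.
Qed.

Lemma strands_below_upper f i :
  strands_below I f (upper i) = (strands_below I f (lower i) + (f (lower i) \in I))%N.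
Proof.
rewrite /strands_below.
have [lI|lI] := boolP (f (lower i) \in I).
  have -> : [set m : 'I_n | (m < upper i)%N && (f m \in I)] =
            lower i |: [set m : 'I_n | (m < lower i)%N && (f m \in I)].
    apply/setP => k; rewrite !inE /= ltnS leq_eqVlt -val_eqE /=.
    by have [ki|//] := eqVneq (k : nat) i; have -> : k = lower i by apply: val_inj.
  by rewrite cardsU1 inE ltnn addnC.
rewrite addn0; apply: eq_card => k; rewrite !inE /= ltnS leq_eqVlt.
have [ki|//] := eqVneq (k : nat) i; have -> : k = lower i by apply: val_inj.
by rewrite (negPf lI) !andbF.
Qed.

Lemma strands_below_simple_refl f i l : l != upper i ->
  strands_below I (f \o simple_refl i) l = strands_below I f l.
Proof.
move=> lu; rewrite /strands_below -[RHS](card_imset _ (@perm_inj _ (simple_refl i))).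
apply: eq_card => k; rewrite -{2}(simple_reflK i k) mem_imset ?inE; last exact: perm_inj.
congr (_ && _); move: lu; rewrite -val_eqE /=.
by rewrite /simple_refl; case: tpermP => [->|->|//] /=; lia.
Qed.

Lemma strands_below_simple_refl_upper f i :
  strands_below I (f \o simple_refl i) (upper i) =
  (strands_below I f (lower i) + (f (upper i) \in I))%N.
Proof.
rewrite strands_below_upper strands_below_simple_refl ?[_ == upper i]eq_sym ?upper_neq_lower //.
by rewrite /= /simple_refl tpermL.
Qed.

Lemma strands_below_bound f l : injective f -> f l \in I -> (strands_below I f l < #|I|)%N.
Proof.
move=> f_inj lI; rewrite /strands_below -(card_imset _ f_inj).
apply/proper_card/properP; split.
  by apply/subsetP => _ /imsetP[k + ->]; rewrite inE => /andP[].
by exists (f l) => //; rewrite (mem_imset _ _ f_inj) inE ltnn.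
Qed.

(** [strands_below] is injective on the levels carrying strands of [I], and there are [#|I|] of
    them, so it attains every value. *)
Lemma strands_below_surj f (j : 'I_#|I|) : injective f ->
  exists2 l, f l \in I & strands_below I f l = j.
Proof.
move=> f_inj.
(* The default [j] only makes [h] total; on [A] the value is in range by [strands_below_bound]. *)
pose h l : 'I_#|I| := insubd j (strands_below I f l).
pose A := [set l | f l \in I].
have hE l : f l \in I -> val (h l) = strands_below I f l.
  by move=> lI; rewrite val_insubd strands_below_bound.
have h_inj : {in A &, injective h}.
  move=> l m; rewrite !inE => lI mI /(congr1 val); rewrite !hE // => /eqP.
  by rewrite strands_below_inj // => /eqP.
have cA : #|A| = #|I|.
  rewrite -(card_imset _ f_inj); apply: eq_card => k.
  have [g fK gK] := injF_bij f_inj.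
  by rewrite -(gK k) (mem_imset _ _ f_inj) inE.
have hT : [set h l | l in A] = setT.
  by apply/eqP; rewrite eqEcard subsetT card_in_imset // cardsT card_ord cA leqnn.
have: j \in [set h l | l in A] by rewrite hT in_setT.
by case/imsetP => l; rewrite inE => lI ->; exists l; rewrite // hE.
Qed.

Definition inner_crossing beta i : bool :=
  (strand_at beta (lower i) \in I) && (strand_at beta (upper i) \in I).

Definition mixed_crossing beta i : bool :=
  (strand_at beta (lower i) \in I) (+) (strand_at beta (upper i) \in I).

Lemma strand_at_rcons beta i : strand_at (rcons beta i) = strand_at beta \o simple_refl i.
Proof. by rewrite /strand_at foldl_rcons. Qed.

Lemma strand_atE beta : strand_at beta =1 coxeter_proj beta.
Proof.
elim/last_ind: beta => [|beta i IH] l; first by rewrite perm1.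
by rewrite strand_at_rcons coxeter_proj_rcons perm_compE -IH.
Qed.

Lemma sub_letter_inner beta i : inner_crossing beta i ->
  exists2 j, sub_letter I beta i = Some j &
             val j = strands_below I (strand_at beta) (lower i).
Proof.
move=> inn; rewrite /sub_letter -/(inner_crossing beta i) inn.
case/andP: inn => lI uI; have lt := strands_below_lt lI uI.
by exists (Ordinal lt) => //; rewrite insubT.
Qed.

Lemma sub_letter_outer beta i : ~~ inner_crossing beta i -> sub_letter I beta i = None.
Proof. by move=> /negPf inn; rewrite /sub_letter -/(inner_crossing beta i) inn. Qed.

Lemma sub_braid_rcons beta i :
  sub_braid I (rcons beta i) =
    oapp (rcons (sub_braid I beta)) (sub_braid I beta) (sub_letter I beta i).
Proof.
(* Indexing by [nat] with [onth] frees the index type from the word, so that [beta] and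
   [rcons beta i] can be compared. *)
pose g b k := oapp (sub_letter I (take k b)) None (onth b k).
have E b : sub_braid I b = pmap (g b) (iota 0 (size b)).
  rewrite /sub_braid -val_enum_ord; elim: (enum _) => //= k s ->.
  rewrite /g; have /tnth_onth := erefl (tnth (in_tuple b) k).
  by move=> /= ->.
rewrite !E size_rcons -[(size beta).+1]addn1 iotaD pmap_cat /= add0n.
have -> : g (rcons beta i) (size beta) = sub_letter I beta i.
  by rewrite /g -cats1 onth_cat ltnn subnn /= take_size_cat.
have -> : pmap (g (rcons beta i)) (iota 0 (size beta)) = pmap (g beta) (iota 0 (size beta)).
  apply: eq_in_pmap => k; rewrite mem_iota add0n /= => kb.
  by rewrite /g -cats1 onth_cat kb take_cat kb.
by case: sub_letter => [j|] /=; rewrite ?cats1 ?cats0.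
Qed.

Lemma sub_braid_nil : sub_braid I [::] = [::].
Proof. by rewrite /sub_braid; case: (enum 'I_0) => // -[]. Qed.

(* Whether the strand at level [l] at the right end of [beta] has moved up an odd
   number of times at mixed crossings: at [z = 0], [braid_gen_mx] is a permutation
   matrix except for a sign on the strand that goes up. *)
Definition strand_flip beta : 'I_n -> bool :=
  (foldl (fun p i =>
     (p.1 \o simple_refl i,
      fun l => p.2 (simple_refl i l) (+)
        ((l == upper i) && ((p.1 (lower i) \in I) (+) (p.1 (upper i) \in I)))))
    (id, fun=> false) beta).2.

Lemma strand_flip_rcons beta i l :
  strand_flip (rcons beta i) l =
  strand_flip beta (simple_refl i l) (+) ((l == upper i) && mixed_crossing beta i).
Proof.
rewrite /strand_flip foldl_rcons /=.
set p := foldl _ _ beta; suff -> : p.1 = strand_at beta by [].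
rewrite {}/p; elim/last_ind: beta => [//|beta j IH].
by rewrite foldl_rcons /= IH strand_at_rcons.
Qed.

(** Both strands carry signs into the crossing; factoring out the sign of the strand going down
    leaves the product of the two signs on the coordinate. *)
Definition crossing_flip beta i : bool :=
  strand_flip beta (lower i) (+) strand_flip beta (upper i).

End SubBraids.

(** * Block decomposition of the braid matrix *)

Section BlockDecomposition.
Variables (K : fieldType) (n : nat) (I : {set 'I_n}).
Implicit Types (beta : braid_word n) (y : nat -> K).

(** Crossings are described by prefixes, so that the condition passes from [rcons beta i] to
    [beta]. *)
Definition mixed_vanish beta y : Prop := forall s i, prefix (rcons s i) beta ->
  mixed_crossing I s i -> y (size s) = 0.

(* The [k]-th crossing, if it survives in [sub_braid I beta], is the crossing of
   index [size (sub_braid I (take k beta))] there. *)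
Definition inner_coords beta y (y1 : nat -> K) : Prop :=
  forall s i, prefix (rcons s i) beta -> inner_crossing I s i ->
    y1 (size (sub_braid I s)) = (-1) ^+ crossing_flip I s i * y (size s).

Lemma prefix_rconsW beta i (s : braid_word n) : prefix s beta -> prefix s (rcons beta i).
Proof. by move=> sb; apply: prefix_trans sb (prefix_rcons _ _). Qed.

(** Column [c] belongs to the strand at level [c]. An unmixed crossing combines columns of strands
    on the same side; a mixed one with coordinate 0 only swaps two columns up to sign. *)
Lemma word_mx_off_block beta y : mixed_vanish beta y ->
  forall r c, (r \in I) != (strand_at beta c \in I) -> word_mx beta y r c = 0.
Proof.
elim/last_ind: beta => [|beta i IH] y0 r c.
  by have [->|rc _] := eqVneq r c; rewrite ?eqxx // word_mx_nil mxE (negPf rc).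
have {}IH := IH (fun s j sb => y0 s j (prefix_rconsW _ sb)).
have := y0 beta i (prefix_refl _).
rewrite word_mx_rcons strand_at_rcons mulmx_braid_gen /= /simple_refl /mixed_crossing => mix rc.
have [cl|cl] := eqVneq c (lower i).
  rewrite cl tpermL in rc; rewrite (IH _ _ rc) addr0.
  have [lu|lu] := eqVneq (strand_at beta (lower i) \in I) (strand_at beta (upper i) \in I).
    by rewrite IH ?mulr0 // lu.
  by rewrite mix ?mul0r //; move: lu; do 2 case: (_ \in I).
have [cu|cu] := eqVneq c (upper i).
  by rewrite cu tpermR in rc; rewrite (IH _ _ rc) oppr0.
have sc : tperm (lower i) (upper i) c = c by rewrite tpermD // eq_sym.
by rewrite sc in rc; apply: IH.
Qed.

(** Inner crossings perform the same column operation in both matrices once the signs are moved into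
    the coordinates; mixed ones only move a column of [I], with the sign recorded by
    [strand_flip]. *)
Lemma word_mx_sub_braid beta y y1 : mixed_vanish beta y -> inner_coords beta y y1 ->
  forall (r c : 'I_n) (r1 c1 : 'I_#|I|),
    r \in I -> strand_at beta c \in I ->
    strands_below I id r = r1 -> strands_below I (strand_at beta) c = c1 ->
    word_mx beta y r c =
      (-1) ^+ strand_flip I beta c * word_mx (sub_braid I beta) y1 r1 c1.
Proof.
elim/last_ind: beta => [|beta i IH] y0 yI r c r1 c1 rI cI rE cE.
  rewrite sub_braid_nil !word_mx_nil !mxE mul1r; congr (nat_of_bool _)%:R.
  by rewrite -(strands_below_inj rI cI) rE cE.
have {}IH := IH (fun s j sb => y0 s j (prefix_rconsW _ sb))
                (fun s j sb => yI s j (prefix_rconsW _ sb)).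
have {y0} mix := y0 beta i (prefix_refl _).
have {yI} inn := yI beta i (prefix_refl _).
have nlu : lower i != upper i by rewrite eq_sym upper_neq_lower.
rewrite word_mx_rcons mulmx_braid_gen strand_flip_rcons sub_braid_rcons.
have [inn1|out] := boolP (inner_crossing I beta i).
  have [j -> jE] := sub_letter_inner inn1; rewrite [oapp _ _ _]/= word_mx_rcons.
  rewrite mulmx_braid_gen inn //.
  have /andP[lI uI] := inn1.
  have lE : strands_below I (strand_at beta) (lower i) = lower j by rewrite -jE.
  have uE : strands_below I (strand_at beta) (upper i) = upper j.
    by rewrite strands_below_upper lI lE addn1.
  have -> : mixed_crossing I beta i = false by rewrite /mixed_crossing lI uI.
  rewrite andbF addbF /crossing_flip.
  have [cl|cl] := eqVneq c (lower i).
    have -> : c1 = lower j.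
      by apply: val_inj; rewrite /= -cE cl strand_at_rcons strands_below_simple_refl.
    rewrite eqxx cl /simple_refl tpermL.
    rewrite (IH r _ r1 (lower j)) // (IH r _ r1 (upper j)) // signr_addb.
    by case: (strand_flip _ _ (lower i)); case: (strand_flip _ _ (upper i));
       rewrite ?expr0 ?expr1; ring.
  have [cu|cu] := eqVneq c (upper i).
    have -> : c1 = upper j.
      apply: val_inj; rewrite /= -cE cu strand_at_rcons strands_below_simple_refl_upper.
      by rewrite uI addn1 -jE.
    rewrite upper_neq_lower eqxx cu /simple_refl tpermR (IH r _ r1 (lower j)) //.
    by rewrite mulrN.
  have sc : simple_refl i c = c by rewrite /simple_refl tpermD // eq_sym.
  rewrite strand_at_rcons /= sc in cI; rewrite strand_at_rcons strands_below_simple_refl // in cE.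
  have cIE := strands_below_inj cI.
  have -> : (c1 == lower j) = false.
    by rewrite -val_eqE -[val c1]cE -[val (lower j)]lE /= cIE // (negPf cl).
  have -> : (c1 == upper j) = false.
    by rewrite -val_eqE -[val c1]cE -[val (upper j)]uE /= cIE // (negPf cu).
  by rewrite sc; apply: IH.
rewrite sub_letter_outer // [oapp _ _ _]/=.
rewrite strand_at_rcons /= in cI cE.
have [cl|cl] := eqVneq c (lower i).
  have lu := nlu; rewrite cl /simple_refl tpermL in cI *.
  rewrite (negPf nlu) addbF.
  have lI : strand_at beta (lower i) \notin I by move: out; rewrite /inner_crossing cI andbT.
  (* The strand of [I] comes down from [upper i] and the other one is outside [I]: the crossing is
     mixed and its coordinate vanishes. *)
  rewrite mix ?mul0r ?add0r; last by rewrite /mixed_crossing cI (negPf lI).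
  apply: IH => //; rewrite strands_below_upper (negPf lI) addn0.
  by rewrite -cE cl strands_below_simple_refl.
have [cu|cu] := eqVneq c (upper i).
  rewrite cu /simple_refl tpermR in cI *.
  have uI : strand_at beta (upper i) \notin I by move: out; rewrite /inner_crossing cI.
  (* Here the strand of [I] goes up, and the entry -1 of the generator flips its sign. *)
  rewrite /= /mixed_crossing cI (negPf uI) addbT signrN mulNr; congr (- _).
  by apply: IH => //; rewrite -cE cu strands_below_simple_refl_upper (negPf uI) addn0.
have sc : simple_refl i c = c by rewrite /simple_refl tpermD // eq_sym.
rewrite sc addbF in cI *; apply: IH => //.
by rewrite -cE strands_below_simple_refl.
Qed.

End BlockDecomposition.

(** * Matching the surviving crossings with the letters of the sub-braid *)

Section CrossingMatching.
Variables (n : nat) (I : {set 'I_n}) (beta : braid_word n).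
Implicit Types (k : 'I_(size beta)) (j : 'I_(size (sub_braid I beta))).

Local Notation crossing k := (tnth (in_tuple beta) k).

Definition inner_at k : bool := inner_crossing I (take k beta) (crossing k).
Definition mixed_at k : bool := mixed_crossing I (take k beta) (crossing k).
Definition flip_at k : bool := crossing_flip I (take k beta) (crossing k).

Lemma prefix_rcons_at (s : braid_word n) i : prefix (rcons s i) beta ->
  exists2 k : 'I_(size beta), k = size s :> nat & take k beta = s /\ crossing k = i.
Proof.
move=> /prefixP[t bE].
have kb : (size s < size beta)%N by rewrite bE cat_rcons size_cat /= addnS ltnS leq_addr.
exists (Ordinal kb) => //; rewrite (tnth_nth i) /=.
by rewrite bE cat_rcons take_size_cat // nth_cat ltnn subnn.
Qed.

Let count a := size (sub_braid I (take a beta)).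

Lemma size_sub_braid_take_succ k : count k.+1 = (count k + inner_at k)%N.
Proof.
rewrite /count (take_nth (crossing k)) // -(tnth_nth _ (in_tuple beta)) sub_braid_rcons.
rewrite /inner_at; have [inn|out] := boolP (inner_crossing _ _ _).
  by have [j -> _] := sub_letter_inner inn; rewrite /= size_rcons addn1.
by rewrite sub_letter_outer // addn0.
Qed.

Lemma size_sub_braid_take_leq a b : (a <= b)%N -> (count a <= count b)%N.
Proof.
elim: b => [|b IH]; first by rewrite leqn0 => /eqP->.
rewrite leq_eqVlt ltnS => /orP[/eqP->//|/IH ab]; apply: leq_trans ab _.
have [bs|sb] := ltnP b (size beta).
  by rewrite (size_sub_braid_take_succ (Ordinal bs)) leq_addr.
by rewrite /count !take_oversize // ltnW.
Qed.

(** A boolean relation rather than a function, so that it can be the range of sums over either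
    index. *)
Definition matching k j : bool :=
  inner_at k && (size (sub_braid I (take k beta)) == j).

Lemma matching_inner k : inner_at k -> exists j, matching k j.
Proof.
move=> inn; have lt : (count k < size (sub_braid I beta))%N.
  rewrite -[X in size (sub_braid _ X)](take_size beta) -/(count _).
  apply: leq_trans (size_sub_braid_take_leq (ltn_ord k)).
  by rewrite size_sub_braid_take_succ inn addn1.
by exists (Ordinal lt); rewrite /matching inn /=.
Qed.

(** [count] grows strictly past an inner crossing. *)
Lemma matching_injl j k k' : matching k j -> matching k' j -> k = k'.
Proof.
have H p q : matching p j -> matching q j -> ~~ (p < q)%N.
  move=> /andP[pI /eqP pj] /andP[_ /eqP qj]; apply/negP => pq.
  have := size_sub_braid_take_leq pq.
  by rewrite size_sub_braid_take_succ pI /count pj qj addn1 ltnn.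
move=> kj kj'; apply: val_inj.
by case: (ltngtP k k') (H _ _ kj kj') (H _ _ kj' kj).
Qed.

Lemma matching_injr k j j' : matching k j -> matching k j' -> j = j'.
Proof. by move=> /andP[_ /eqP e] /andP[_ /eqP e']; apply: val_inj; rewrite /= -e -e'. Qed.

(** [count] rises from 0 in steps of at most one, so it passes from [j] to [j + 1] at some inner
    crossing. *)
Lemma matching_surj j : exists k, matching k j.
Proof.
have H a : (a <= size beta)%N -> (j < count a)%N -> exists k, matching k j.
  elim: a => [|a IH] ab; first by rewrite /count take0 sub_braid_nil.
  have [/IH|] := ltnP j (count a); first by move=> H _; apply: H; apply: ltnW.
  rewrite (size_sub_braid_take_succ (Ordinal ab)) => cj.
  case inn : (inner_at _); last by rewrite addn0 ltnNge cj.
  rewrite addn1 ltnS => jc; exists (Ordinal ab).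
  by rewrite /matching inn eqn_leq cj.
by apply: (H (size beta)); rewrite // /count take_size.
Qed.

End CrossingMatching.

(** * Restriction and extension of coordinates; the torus action *)

Section Coordinates.
Variables (K : fieldType) (n : nat) (beta : braid_word n).
Implicit Types (I : {set 'I_n}) (z : 'rV[K]_(size beta)).

(** Extended by 0 to all of [nat], since [word_mx] reads its coordinates from a sequence. *)
Definition coord m (z : 'rV[K]_m) (k : nat) : K := oapp (z ord0) 0 (insub k).

Lemma coordE m (z : 'rV[K]_m) (k : 'I_m) : coord z k = z ord0 k.
Proof. by rewrite /coord valK. Qed.

Lemma row_coord m (z : 'rV[K]_m) : \row_(k < m) coord z k = z.
Proof. by apply/rowP => k; rewrite mxE coordE. Qed.

Definition compatible I z (u : 'rV[K]_(size (sub_braid I beta))) : Prop :=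
  forall k j, matching k j -> u ord0 j = (-1) ^+ flip_at I k * z ord0 k.

Lemma compatible_inner_coords I z u : @compatible I z u ->
  inner_coords I beta (coord z) (coord u).
Proof.
move=> zz s i /prefix_rcons_at[k ks [sk ik]] inn.
have innk : inner_at I k by rewrite /inner_at sk ik.
have [j kj] := matching_inner innk.
have /andP[_ /eqP] := kj; rewrite sk -ks => ->.
by rewrite !coordE (zz _ _ kj) /flip_at sk ik.
Qed.

Definition mixed_zero I z : Prop := forall k, mixed_at I k -> z ord0 k = 0.

Lemma mixed_zero_vanish I z : mixed_zero I z -> mixed_vanish I beta (coord z).
Proof.
move=> z0 s i /prefix_rcons_at[k ks [sk ik]] mix.
by rewrite -ks coordE z0 // /mixed_at sk ik.
Qed.

(** Each sum has exactly one term; this form avoids choosing the crossing and is visibly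
    polynomial. *)
Definition restrict I z : 'rV[K]_(size (sub_braid I beta)) :=
  \row_j \sum_(k | matching k j) (-1) ^+ flip_at I k * z ord0 k.

Lemma compatible_restrict I z : compatible z (restrict I z).
Proof.
move=> k j kj; rewrite mxE (big_pred1 k) // => k'.
by apply/idP/eqP => [/matching_injl|->//]; apply.
Qed.

Lemma compatible_uniq I z u u' : @compatible I z u -> @compatible I z u' -> u = u'.
Proof.
move=> zz zz'; apply/rowP => j; have [k kj] := matching_surj j.
by rewrite (zz _ _ kj) (zz' _ _ kj).
Qed.

(** For disjoint [I1] and [I2] at most one term survives, and a crossing between the two parts
    matches nothing and gets 0. *)
Definition extend I1 I2 (u : 'rV[K]_(size (sub_braid I1 beta)))
    (v : 'rV[K]_(size (sub_braid I2 beta))) : 'rV[K]_(size beta) :=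
  \row_k (\sum_(j | matching k j) (-1) ^+ flip_at I1 k * u ord0 j +
          \sum_(j | matching k j) (-1) ^+ flip_at I2 k * v ord0 j).

Lemma sum_matching I (k : 'I_(size beta)) j (g : 'I_(size (sub_braid I beta)) -> K) :
  matching k j -> \sum_(j' | matching k j') g j' = g j.
Proof.
move=> kj; rewrite (big_pred1 j) // => j'.
by apply/idP/eqP => [/matching_injr|->//]; apply.
Qed.

Lemma sum_matching_outer I (k : 'I_(size beta)) (g : 'I_(size (sub_braid I beta)) -> K) :
  ~~ inner_at I k -> \sum_(j | matching k j) g j = 0.
Proof. by move=> /negPf out; rewrite big1 // => j; rewrite /matching out. Qed.

Lemma extendC I1 I2 u v : @extend I1 I2 u v = @extend I2 I1 v u.
Proof. by apply/rowP => k; rewrite !mxE addrC. Qed.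

Lemma compatible_extendl I1 I2 u v : [disjoint I1 & I2] ->
  compatible (@extend I1 I2 u v) u.
Proof.
move=> dis k j kj; rewrite mxE (sum_matching _ kj) sum_matching_outer.
  by rewrite addr0 mulrA -expr2 sqrr_sign mul1r.
have /andP[/andP[lI _] _] := kj.
by rewrite /inner_at /inner_crossing (disjointFr dis lI).
Qed.

Lemma compatible_extendr I1 I2 u v : [disjoint I1 & I2] ->
  compatible (@extend I1 I2 u v) v.
Proof. by rewrite extendC disjoint_sym; apply: compatible_extendl. Qed.

Lemma mixed_at_setC I (k : 'I_(size beta)) : mixed_at (~: I) k = mixed_at I k.
Proof. by rewrite /mixed_at /mixed_crossing !inE addbN addNb negbK. Qed.

Lemma crossing_cases I (k : 'I_(size beta)) :
  [|| mixed_at I k, inner_at I k | inner_at (~: I) k].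
Proof.
rewrite /mixed_at /mixed_crossing /inner_at /inner_crossing !inE.
by do 2 case: (_ \in I).
Qed.

Lemma mixed_zero_extend I u v : mixed_zero I (@extend I (~: I) u v).
Proof.
move=> k mix; rewrite mxE !sum_matching_outer ?addr0 //;
  move: mix; rewrite /mixed_at /mixed_crossing /inner_at /inner_crossing ?inE;
  by do 2 case: (_ \in I).
Qed.

(** Each crossing is mixed or inner to one of the two parts, and at an inner one [compatible]
    determines the coordinate because a sign can be cancelled. *)
Lemma restrictK I z : mixed_zero I z -> extend (restrict I z) (restrict (~: I) z) = z.
Proof.
move=> z0; apply/rowP => k.
have [mix|nmix] := boolP (mixed_at I k); first by rewrite mixed_zero_extend // z0.
have K1 J z' : compatible z (restrict J z) -> inner_at J k -> compatible z' (restrict J z) ->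
    z' ord0 k = z ord0 k.
  move=> zz /matching_inner[j kj] /(_ _ _ kj); rewrite (zz _ _ kj).
  by move/(can_inj (signrMK _)).
have dis : [disjoint I & ~: I] by rewrite -setI_eq0 setICr.
have := crossing_cases I k; rewrite (negPf nmix) /= => /orP[inn|inn].
  by apply: (K1 I) => //; [apply: compatible_restrict | apply: compatible_extendl].
by apply: (K1 (~: I)) => //; [apply: compatible_restrict | apply: compatible_extendr].
Qed.

(** At an unmixed crossing both strands have the same torus parameter, so the weight is 1. *)
Lemma torus_act_mixed_zero I z t : mixed_zero I z -> in_subtorus I (~: I) t ->
  torus_act t z = z.
Proof.
move=> z0 [t0 tE]; apply/rowP => k; rewrite mxE /=.
have [mix|nmix] := boolP (mixed_at I k); first by rewrite z0 // mulr0.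
rewrite (tE _ (strand_at (take k beta) (upper (tnth (in_tuple beta) k)))) ?divff ?mul1r //.
have := crossing_cases I k; rewrite (negPf nmix) /= /inner_at /inner_crossing.
by rewrite orbC => /orP[->|->]; rewrite ?orbT.
Qed.

(** The test element is [a] on the strands of [I] and 1 elsewhere: at a mixed crossing its weight is
    [a] or its inverse, which differs from 1. *)
Lemma mixed_zero_stabilized I z (a : K) : a != 0 -> a != 1 ->
  (forall t, in_subtorus I (~: I) t -> torus_act t z = z) -> mixed_zero I z.
Proof.
move=> a0 a1 stab k mix.
pose t : 'rV[K]_n := \row_p if p \in I then a else 1.
have /stab/rowP/(_ k) : in_subtorus I (~: I) t.
  split=> [p|p q]; rewrite !mxE; first by case: ifP => _; rewrite ?a0 ?oner_eq0.
  by rewrite !inE; do 2 case: (_ \in I).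
rewrite mxE /= !mxE; move: mix; rewrite /mixed_at /mixed_crossing.
have E (c : K) : c != 1 -> c * z ord0 k = z ord0 k -> z ord0 k = 0.
  move=> c1 /eqP; rewrite -subr_eq0 -{2}[z _ _]mul1r -mulrBl mulf_eq0 subr_eq0.
  by rewrite (negPf c1) => /eqP.
case: (_ \in I); case: (_ \in I) => //= _; apply: E; rewrite ?divr1 ?div1r //.
by rewrite -(inj_eq invr_inj) invrK invr1.
Qed.

End Coordinates.

(** * Compatibility of the antidiagonals *)

Section Antitriangular.
Variables (K : fieldType) (n : nat) (I : {set 'I_n}) (beta : braid_word n).
(** Stability of [I] under w w0, evaluated at [rev_ord m]. *)
Hypothesis rev_I : forall m, (strand_at beta m \in I) = (rev_ord m \in I).

(** By [rev_I], reversal carries the levels counted by the first term to the elements of [I] above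
    [rev_ord c]; with those below and [rev_ord c] itself they exhaust [I]. *)
Lemma strands_below_rev c : strand_at beta c \in I ->
  (strands_below I (strand_at beta) c + strands_below I id (rev_ord c)).+1 = #|I|.
Proof.
rewrite rev_I => cI; rewrite /strands_below.
rewrite -(card_imset _ (@rev_ord_inj n)).
rewrite [RHS](cardsD1 (rev_ord c)) cI add1n; congr _.+1.
rewrite -cardsUI [X in (_ + #|pred_of_set X|)%N](_ : _ = set0) ?cards0 ?addn0.
  apply: eq_card => m.
  rewrite -{1}(rev_ordK m) inE (mem_imset _ _ rev_ord_inj) !inE rev_I rev_ordK -andb_orl.
  congr (_ && _); rewrite -val_eqE /=.
  have := ltn_ord m; have := ltn_ord c; lia.
apply/setP => m; rewrite -(rev_ordK m) inE (mem_imset _ _ rev_ord_inj) !inE /=.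
have := ltn_ord m; have := ltn_ord c; lia.
Qed.

(** Both sides compare [r] with [rev_ord c], the left one by counting the elements of [I] below
    each. *)
Lemma strands_below_antidiagonal r c : r \in I -> strand_at beta c \in I ->
  (strands_below I id r + strands_below I (strand_at beta) c < #|I|.-1)%N = (r + c < n.-1)%N.
Proof.
move=> rI cI; rewrite -(strands_below_rev cI) /= addnC ltn_add2l.
have -> : (r + c < n.-1)%N = (r < rev_ord c)%N.
  by rewrite /=; have := ltn_ord r; have := ltn_ord c; lia.
apply/idP/idP; last exact: strands_below_ltn.
by apply: contraTT; rewrite -!leqNgt; apply: strands_below_leq.
Qed.

Lemma antitriangular_sub_braid (y y1 : nat -> K) :
  mixed_vanish I beta y -> inner_coords I beta y y1 ->
  antitriangular (word_mx beta y) -> antitriangular (word_mx (sub_braid I beta) y1).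
Proof.
move=> y0 yI anti r1 c1.
have [r rI rE] := strands_below_surj r1 (@inj_id _).
have [c cI cE] := strands_below_surj c1 (@strand_at_inj _ beta).
rewrite -rE -cE strands_below_antidiagonal // => /anti.
by rewrite (word_mx_sub_braid y0 yI rI cI rE cE) => /eqP; rewrite mulf_eq0 signr_eq0 => /eqP.
Qed.

Lemma sub_braid_antitriangular (y y1 : nat -> K) :
  mixed_vanish I beta y -> inner_coords I beta y y1 ->
  antitriangular (word_mx (sub_braid I beta) y1) ->
  forall r c : 'I_n, r \in I -> strand_at beta c \in I -> (r + c < n.-1)%N ->
    word_mx beta y r c = 0.
Proof.
move=> y0 yI anti r c rI cI.
have rb := strands_below_bound (@inj_id _) rI.
have cb := strands_below_bound (@strand_at_inj _ beta) cI.
rewrite -(strands_below_antidiagonal rI cI) => rc.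
rewrite (word_mx_sub_braid (r1 := Ordinal rb) (c1 := Ordinal cb) y0 yI) //.
by rewrite anti ?mulr0.
Qed.

End Antitriangular.

(** * Fixed points of the subtorus and the isomorphism *)

Lemma union_of_orbits_closed n (u : 'S_n) (I : {set 'I_n}) x :
  union_of_orbits u I -> (u x \in I) = (x \in I).
Proof.
case=> P /subsetP PS ->.
have H w z : (z \in porbit u w) = (porbit u z == porbit u w).
  by rewrite eq_porbit_mem porbit_sym.
apply/bigcupP/bigcupP => -[B BP xB]; exists B => //; move: xB;
  have /imsetP[w _ ->] := PS _ BP; rewrite !H;
  by have -> : porbit u (u x) = porbit u x by apply/eqP; rewrite eq_porbit_mem -{1}[u]expg1 mem_porbit.
Qed.

Lemma braid_varietyE (K : fieldType) n (beta : braid_word n) (z : 'rV[K]_(size beta)) :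
  demazure beta = rev_perm n ->
  braid_variety K beta z <-> antitriangular (word_mx beta (coord z)).
Proof. by move=> bw; rewrite -(braid_variety_rev _ bw) row_coord. Qed.

Section FixedPoints.
Variables (K : fieldType) (n : nat) (beta : braid_word n) (I : {set 'I_n}) (a : K).
Hypotheses (a0 : a != 0) (a1 : a != 1).
Hypothesis longest : demazure beta = rev_perm n.
Hypothesis rev_I : forall m, (strand_at beta m \in I) = (rev_ord m \in I).

Let rev_IC m : (strand_at beta m \in ~: I) = (rev_ord m \in ~: I).
Proof. by rewrite !inE rev_I. Qed.

Lemma stabilized_mixed_zero (z : 'rV[K]_(size beta)) :
  stabilized_points K beta I (~: I) z -> mixed_zero I z.
Proof. by case=> _; apply: mixed_zero_stabilized a0 a1. Qed.

Lemma mixed_zeroC (z : 'rV[K]_(size beta)) : mixed_zero I z -> mixed_zero (~: I) z.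
Proof. by move=> z0 k; rewrite mixed_at_setC; apply: z0. Qed.

(** Serves the isomorphism and, through [antitriangular_demazure], the emptiness claim. *)
Lemma stabilized_antitriangular (z : 'rV[K]_(size beta)) :
  stabilized_points K beta I (~: I) z ->
  antitriangular (word_mx (sub_braid I beta) (coord (restrict I z))) /\
  antitriangular (word_mx (sub_braid (~: I) beta) (coord (restrict (~: I) z))).
Proof.
move=> st; have z0 := stabilized_mixed_zero st.
case: st => /(braid_varietyE _ longest) anti _.
split; apply: antitriangular_sub_braid anti => //.
- exact: mixed_zero_vanish.
- exact/compatible_inner_coords/compatible_restrict.
- exact/mixed_zero_vanish/mixed_zeroC.
- exact/compatible_inner_coords/compatible_restrict.
Qed.

Lemma stabilized_extend (u : 'rV[K]_(size (sub_braid I beta)))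
    (v : 'rV[K]_(size (sub_braid (~: I) beta))) :
  antitriangular (word_mx (sub_braid I beta) (coord u)) ->
  antitriangular (word_mx (sub_braid (~: I) beta) (coord v)) ->
  stabilized_points K beta I (~: I) (extend u v).
Proof.
move=> antiu antiv; set z := extend u v.
have z0 : mixed_zero I z by apply: mixed_zero_extend.
have dis : [disjoint I & ~: I] by rewrite -setI_eq0 setICr.
split=> [|t]; last exact: torus_act_mixed_zero.
apply/(braid_varietyE _ longest) => r c rc.
(* The diagonal blocks vanish above the antidiagonal by the two factors, the off-diagonal ones
   because mixed coordinates are 0. *)
have [rI|rI] := boolP (r \in I); have [cI|cI] := boolP (strand_at beta c \in I).
- apply: (sub_braid_antitriangular rev_I _ _ antiu) => //.
    exact: mixed_zero_vanish.
  exact/compatible_inner_coords/compatible_extendl.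
- by apply: (@word_mx_off_block _ _ I); rewrite ?rI ?(negPf cI) //; apply: mixed_zero_vanish.
- by apply: (@word_mx_off_block _ _ I); rewrite ?cI ?(negPf rI) //; apply: mixed_zero_vanish.
apply: (sub_braid_antitriangular rev_IC _ _ antiv); rewrite ?inE //.
  exact/mixed_zero_vanish/mixed_zeroC.
exact/compatible_inner_coords/compatible_extendr.
Qed.

Local Notation X1 := (braid_variety K (sub_braid I beta)).
Local Notation X2 := (braid_variety K (sub_braid (~: I) beta)).

Definition restrict_poly
    (j : 'I_(size (sub_braid I beta) + size (sub_braid (~: I) beta))) :
    {mpoly K[size beta]} :=
  match split j with
  | inl j1 => \sum_(k | matching k j1) (-1) ^+ flip_at I k *: 'X_k
  | inr j2 => \sum_(k | matching k j2) (-1) ^+ flip_at (~: I) k *: 'X_k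
  end.

Definition extend_poly (k : 'I_(size beta)) :
    {mpoly K[size (sub_braid I beta) + size (sub_braid (~: I) beta)]} :=
  \sum_(j | matching k j) (-1) ^+ flip_at I k *: 'X_(lshift _ j) +
  \sum_(j | matching k j) (-1) ^+ flip_at (~: I) k *: 'X_(rshift _ j).

Lemma restrict_polyE (z : 'rV[K]_(size beta)) :
  poly_map restrict_poly z = row_mx (restrict I z) (restrict (~: I) z).
Proof.
apply/rowP => j; rewrite !mxE /restrict_poly; case: (split j) => j';
  rewrite mxE rmorph_sum; apply: eq_bigr => k _; by rewrite /= mevalZ mevalXU.
Qed.

Lemma extend_polyE z : poly_map extend_poly z = extend (lsubmx z) (rsubmx z).
Proof.
apply/rowP => k; rewrite !mxE mevalD !rmorph_sum.
by congr (_ + _); apply: eq_bigr => j _; rewrite /= mevalZ mevalXU !mxE.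
Qed.

Lemma stabilized_points_isomorphic :
  demazure (sub_braid I beta) = rev_perm #|I| ->
  demazure (sub_braid (~: I) beta) = rev_perm #|~: I| ->
  isomorphic_sets (stabilized_points K beta I (~: I)) (product_set X1 X2).
Proof.
move=> w1 w2; have dis : [disjoint I & ~: I] by rewrite -setI_eq0 setICr.
exists restrict_poly, extend_poly; split=> z.
  move=> st; rewrite restrict_polyE extend_polyE row_mxKl row_mxKr.
  split; last exact/restrictK/stabilized_mixed_zero.
  have [anti1 anti2] := stabilized_antitriangular st.
  by split; rewrite ?row_mxKl ?row_mxKr; apply/braid_varietyE.
case=> /(braid_varietyE _ w1) anti1 /(braid_varietyE _ w2) anti2.
rewrite extend_polyE restrict_polyE; split; first exact: stabilized_extend.
rewrite -[RHS]hsubmxK; congr row_mx;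
  apply: compatible_uniq; [exact: compatible_restrict| exact: compatible_extendl
                          |exact: compatible_restrict| exact: compatible_extendr].
Qed.

Lemma stabilized_points_empty (z : 'rV[K]_(size beta)) :
  stabilized_points K beta I (~: I) z ->
  demazure (sub_braid I beta) = rev_perm #|I| /\
  demazure (sub_braid (~: I) beta) = rev_perm #|~: I|.
Proof.
by case/stabilized_antitriangular => /antitriangular_demazure-> /antitriangular_demazure->.
Qed.

End FixedPoints.

Theorem theorem6p15 (R : realType) (n : nat) (beta : braid_word n)
    (hbeta : demazure beta = longest_perm n)
    (I1 I2 : {set 'I_n})
    (hdisj : [disjoint I1 & I2]) (hcover : I1 :|: I2 = [set: 'I_n])
    (horb1 : union_of_orbits (perm_comp (coxeter_proj beta) (longest_perm n)) I1)
    (horb2 : union_of_orbits (perm_comp (coxeter_proj beta) (longest_perm n)) I2) :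
  let beta1 := sub_braid I1 beta in
  let beta2 := sub_braid I2 beta in
  let both_longest :=
    demazure beta1 = longest_perm #|I1| /\ demazure beta2 = longest_perm #|I2| in
  (both_longest ->
     isomorphic_sets (stabilized_points R[i] beta I1 I2)
       (product_set (braid_variety R[i] beta1) (braid_variety R[i] beta2))) /\
  (~ both_longest ->
     forall z : 'rV[R[i]]_(size beta), ~ stabilized_points R[i] beta I1 I2 z).
Proof.
have EI2 : I2 = ~: I1.
  apply/setP => x; rewrite inE; have := in_setT x; rewrite -hcover inE.
  by case: (boolP (x \in I1)) => [xI|] //=; rewrite (disjointFr hdisj xI).
subst I2; rewrite !longest_permE in hbeta horb1 *.
have rev_I m : (strand_at beta m \in I1) = (rev_ord m \in I1).
  (* At [rev_ord m], the permutation w w0 takes the value w m, the strand at level [m] at the right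
     end. *)
  rewrite -[RHS](union_of_orbits_closed _ horb1) perm_compE -strand_atE.
  by rewrite [rev_perm n _]permE rev_ordK.
(* The scalar 2 is the test value [a] of [mixed_zero_stabilized]. *)
have two0 : 2%:R != 0 :> R[i] by rewrite Num.Theory.pnatr_eq0.
have two1 : 2%:R != 1 :> R[i] by rewrite Num.Theory.pnatr_eq1.
split=> [[w1 w2]|not_both z /(stabilized_points_empty two0 two1 hbeta rev_I)].
  exact: (stabilized_points_isomorphic two0 two1 hbeta rev_I w1 w2).
exact: not_both.
Qed.
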